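(* Let $n\ge 3$ be an integer and let $K=\{123,231\}\{213,132\}$. The number of equivalence classes of $S_n$ under $K$-equivalence is $n^2-3n+4$.
   Context: Permutations in $S_n$ are written as words $\pi_1\pi_2\cdots\pi_n$ in one-line notation. The order permutation of a word $u$ of $c$ distinct positive integers is the unique $\sigma\in S_c$ with $\sigma_i<\sigma_j$ iff $u_i<u_j$. A replacement partition $K$ of $S_c$ is a set partition of $S_c$; it is denoted by listing its parts with the one-element parts (and outer brackets) omitted, so here $K$ is the set partition of $S_3$ whose only parts of size greater than one are $\{123,231\}$ and $\{213,132\}$. The $K$-equivalence on $S_n$ is the equivalence relation generated by: $\phi\equiv\psi$ whenever $\phi=aub$ and $\psi=avb$ (concatenations) for some possibly empty words $a,b$ and words $u,v$ of length $c$ (so $u,v$ occupy the same $c$ consecutive positions) such that the order permutations of $u$ and $v$ lie in the same part of $K$. All equivalence classes are counted, including one-element classes. *)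

(* Defs.v *)
From Stdlib Require Import Relations.
From mathcomp Require Import all_boot all_fingroup.
Set Implicit Arguments.
Unset Strict Implicit.
Unset Printing Implicit Defensive.

(* 'S_n permutes {0, ..., n-1}; words use the values 1, ..., n. *)
Definition one_line (n : nat) (s : 'S_n) : seq nat :=
  [seq (val (s i)).+1 | i <- enum 'I_n].

Definition is_order_perm (c : nat) (u : seq nat) (sigma : 'S_c) : bool :=
  (size u == c) &&
  [forall i : 'I_c, forall j : 'I_c,
     (sigma i < sigma j) == (nth 0 u i < nth 0 u j)].

Definition block_of_words (c : nat) (B : seq (seq nat)) : {set 'S_c} :=
  [set s | one_line s \in B].

(* Each B in L lists the one-line words of one part; every permutation that
   is not listed forms a part of its own. *)
Definition replacement_partition (c : nat) (L : seq (seq (seq nat))) :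
    {set {set 'S_c}} :=
  let listed := [set:: [seq block_of_words c B | B <- L]] in
  listed :|: [set [set s] | s in ~: cover listed].

Definition same_part (c : nat) (K : {set {set 'S_c}}) (u v : seq nat) : bool :=
  [exists P in K, exists sigma in P, exists tau in P,
     is_order_perm u sigma && is_order_perm v tau].

(* k is the length of the common prefix a in phi = a u b, psi = a v b;
   see kstepP. *)
Definition kstep (c : nat) (K : {set {set 'S_c}}) (n : nat) : rel 'S_n :=
  fun phi psi =>
    let w := one_line phi in let w' := one_line psi in
    [exists k : 'I_n.+1,
       [&& take k w == take k w', drop (k + c) w == drop (k + c) w'
         & same_part K (take c (drop k w)) (take c (drop k w'))]].

(* The reflexive transitive closure is the generated equivalence because kstep
   is symmetric; see kequivP. *)
Definition kequiv (c : nat) (K : {set {set 'S_c}}) (n : nat) : rel 'S_n :=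
  connect (@kstep c K n).

Definition kclasses (c : nat) (K : {set {set 'S_c}}) (n : nat) :
    {set {set 'S_n}} :=
  equivalence_partition (@kequiv c K n) [set: 'S_n].

Lemma size_one_line n (s : 'S_n) : size (one_line s) = n.
Proof. by rewrite size_map size_enum_ord. Qed.

Lemma one_line_inj n : injective (@one_line n).
Proof.
move=> s t st; apply/permP => i; apply/val_inj.
have /eq_in_map/(_ i) := st.
by rewrite mem_enum => /(_ isT) [].
Qed.

Lemma same_part_size c (K : {set {set 'S_c}}) u v :
  same_part K u v -> size u = c /\ size v = c.
Proof.
by case/exists_inP=> P _ /exists_inP[s _] /exists_inP[t _]
  /andP[/andP[/eqP-> _] /andP[/eqP-> _]].
Qed.

Lemma kstepP c (K : {set {set 'S_c}}) n (phi psi : 'S_n) :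
  reflect (exists a u v b : seq nat,
             [/\ one_line phi = a ++ u ++ b, one_line psi = a ++ v ++ b &
                 exists2 P, P \in K &
                 exists sigma tau, [/\ sigma \in P, tau \in P,
                   is_order_perm u sigma & is_order_perm v tau]])
          (kstep K phi psi).
Proof.
have sameP u v : reflect (exists2 P, P \in K & exists sigma tau,
    [/\ sigma \in P, tau \in P, is_order_perm u sigma & is_order_perm v tau])
    (same_part K u v).
  apply: (iffP exists_inP) => -[P PK].
    case/exists_inP=> s sP /exists_inP[t tP /andP[us vt]].
    by exists P => //; exists s, t.
  case=> s [t [sP tP us vt]]; exists P => //.
  by apply/exists_inP; exists s => //; apply/exists_inP; exists t; rewrite ?us.
apply: (iffP existsP) => [[k /and3P[/eqP tk /eqP dk uv]]|].
  exists (take k (one_line phi)), (take c (drop k (one_line phi))),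
    (take c (drop k (one_line psi))), (drop (k + c) (one_line phi)).
  split; last exact/sameP.
    by rewrite addnC -drop_drop !cat_take_drop.
  by rewrite tk dk addnC -drop_drop !cat_take_drop.
case=> a [u [v [b [e1 e2 /sameP uv]]]].
have [su sv] := same_part_size uv.
have ha : size a < n.+1.
  by rewrite ltnS -(size_one_line phi) e1 size_cat leq_addr.
exists (Ordinal ha) => /=.
rewrite e1 e2 addnC -!drop_drop !(drop_size_cat _ (erefl (size a))).
rewrite !(take_size_cat _ (erefl (size a))) eqxx.
by rewrite !drop_size_cat // !take_size_cat // eqxx.
Qed.

Lemma kstep_sym c (K : {set {set 'S_c}}) n : symmetric (@kstep c K n).
Proof.
suff H phi psi : kstep K phi psi -> @kstep c K n psi phi.
  by move=> phi psi; apply/idP/idP; apply: H.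
case/kstepP=> a [u [v [b [e1 e2 [P PK [s [t [sP tP us vt]]]]]]]].
apply/kstepP; exists a, v, u, b; split=> //.
by exists P => //; exists t, s.
Qed.

Lemma kequivP c (K : {set {set 'S_c}}) n (phi psi : 'S_n) :
  reflect (clos_refl_sym_trans 'S_n (@kstep c K n) phi psi) (kequiv K phi psi).
Proof.
apply: (iffP idP).
  case/connectP=> p; elim: p phi => [|x p IH] phi /=.
    by move=> _ ->; apply: rst_refl.
  case/andP=> h hp hl; apply: rst_trans (IH _ hp hl).
  exact: rst_step.
elim=> [x y h|x|x y _|x y z _ h1 _ h2]; first exact: connect1.
- exact: connect0.
- by rewrite /kequiv (sym_connect_sym (@kstep_sym c K n)).
exact: connect_trans h1 h2.
Qed.

Lemma kequiv_equivalence c (K : {set {set 'S_c}}) n :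
  {in [set: 'S_n] & &, equivalence_rel (@kequiv c K n)}.
Proof.
move=> x y z _ _ _; split; first exact: connect0.
by move=> h; apply: (same_connect _ h); apply: sym_connect_sym; apply: kstep_sym.
Qed.

Lemma replacement_partitionP c (L : seq (seq (seq nat))) :
    (forall B, B \in L -> exists s : 'S_c, one_line s \in B) ->
    (forall B C s, B \in L -> C \in L -> s \in B -> s \in C -> B = C) ->
  partition (replacement_partition c L) [set: 'S_c].
Proof.
move=> Lne Ldis; rewrite /replacement_partition.
set D := [set:: _].
have inD P : P \in D -> exists2 B, B \in L & P = block_of_words c B.
  by rewrite inE => /mapP.
apply/and3P; split.
- apply/eqP/setP=> s; rewrite inE; apply/bigcupP.
  have [/bigcupP[P PD sP]|sD] := boolP (s \in cover D).
    by exists P => //; rewrite inE PD.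
  exists [set s]; last exact: set11.
  by rewrite inE; apply/orP; right; apply/imsetP; exists s; rewrite ?inE.
- apply/trivIsetP=> P Q PK QK PQ; rewrite -setI_eq0.
  apply: contraNT PQ => /set0Pn[s /setIP[sP sQ]].
  move: PK QK sP sQ; rewrite !in_setU.
  case/orP=> [PD|/imsetP[x xD ->]]; case/orP=> [QD|/imsetP[y yD ->]].
  + have [B BL ->] := inD _ PD; have [C CL ->] := inD _ QD.
    by rewrite !inE => sB sC; rewrite (Ldis _ _ _ BL CL sB sC).
  + move=> sP /set1P sy; case/negP: (etrans (esym (in_setC _ _)) yD).
    by apply/bigcupP; exists P; rewrite -?sy.
  + move=> /set1P sx sQ; case/negP: (etrans (esym (in_setC _ _)) xD).
    by apply/bigcupP; exists Q; rewrite -?sx.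
  by move=> /set1P <- /set1P <-.
- apply/negP; rewrite in_setU => /orP[/inD[B BL e]|/imsetP[x _ e]].
    have [s sB] := Lne _ BL.
    by have := in_set0 s; rewrite e inE sB.
  by have := in_set0 x; rewrite e set11.
Qed.

(* Main.v *)
Require Import Defs.
From Stdlib Require Import Relations.
From mathcomp Require Import all_boot all_fingroup zify.

Set Implicit Arguments.
Unset Strict Implicit.
Unset Printing Implicit Defensive.

(** In a window of three letters, both nontrivial parts of the partition say
    the same thing: the equivalence is generated by y p M <-> p M y, where M is
    the largest of the three letters.  In other words an ascent p M passes over
    any letter smaller than M, and nothing else happens.

    Let w be a word on 1, ..., n.  A leading n never moves, so an initial run
    n (n-1) ... (m+1) is frozen and the question is about the words on
    1, ..., m that do not begin with m.  In such a word m has a predecessor p,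
    and the block p m can be carried anywhere; so only p and the word s left
    by deleting the block matter.  An initial run (m-1) ... (t+1) of s is again
    frozen.  Taking both runs maximal, the pair (m, t) is an invariant
    ([levels_rotates]), and so is the parity of the number of inversions, each
    move being a 3-cycle ([odd_inversions_rotates]).

    Conversely, let (m, t) be given.  If t is not already the predecessor of m,
    one move makes it so, up to carrying the block p m ([eqv_glued]).  In the presence
    of the block t m any three consecutive letters among the remaining t-1 can
    be rotated ([eqv_rot3]), hence they can be permuted by the whole
    alternating group ([eqv_ends]).  Therefore (m, t) and the parity determine
    the class ([eqv_reps]).

    Each m from 2 to n allows t = 1, ..., m-1, with both parities when t >= 3
    and one parity when t <= 2: this gives 1 class for m = 2 and 2(m-2) classes
    for m >= 3.  With the class of the decreasing word the total is
    (n-1)(n-2) + 2. *)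

(** * Words on an initial segment of the integers *)

(** The words on the letters 1, ..., n, each used once. *)
Definition word (n : nat) (w : seq nat) : bool := perm_eq w (iota 1 n).

Lemma word_mem n w x : word n w -> (x \in w) = (0 < x <= n).
Proof. by move/perm_mem->; rewrite mem_iota add1n ltnS. Qed.

Lemma word_size n w : word n w -> size w = n.
Proof. by move/perm_size; rewrite size_iota. Qed.

Lemma word_uniq n w : word n w -> uniq w.
Proof. by move/perm_uniq->; rewrite iota_uniq. Qed.

Lemma word_ins n a b : word n.+1 (a ++ n.+1 :: b) = word n (a ++ b).
Proof.
have -> : word n.+1 (a ++ n.+1 :: b) = perm_eq (a ++ n.+1 :: b) (iota 1 n ++ [:: n.+1]).
  by rewrite /word -[in iota _ _](addn1 n) iotaD add1n.
by rewrite -cat1s perm_catCA perm_sym perm_catC perm_cons perm_sym.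
Qed.

Lemma word_cons n s : word n.+1 (n.+1 :: s) = word n s.
Proof. exact: (word_ins n [::]). Qed.

Lemma word_all_lt n w k : word n w -> n < k -> all (fun x => x < k) w.
Proof.
by move=> ww nk; apply/allP=> x; rewrite (word_mem _ ww) => /andP[_ /leq_ltn_trans->].
Qed.

Lemma word_perm n u v : perm_eq u v -> word n u = word n v.
Proof. by move=> uv; rewrite /word (permPl uv). Qed.

Lemma uniq_notin (x : nat) a b : uniq (a ++ x :: b) -> x \notin a /\ x \notin b.
Proof.
by rewrite cat_uniq /= negb_or => /and3P[_ /andP[-> _] /andP[-> _]].
Qed.

(** * The moves on words *)

(** One move: three consecutive letters y p M, where M is the largest, become
    p M y.  It is 123 -> 231 when y < p and 213 -> 132 when p < y. *)
Definition rotates (w w' : seq nat) : Prop :=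
  exists a b y p M, [/\ y < M, p < M, w = a ++ [:: y, p, M & b]
                      & w' = a ++ [:: p, M, y & b]].

(** The equivalence on words generated by the moves. *)
Definition eqv : seq nat -> seq nat -> Prop := clos_refl_sym_trans _ rotates.

Lemma eqv_refl w : eqv w w. Proof. exact: rst_refl. Qed.
Lemma eqv_sym u v : eqv u v -> eqv v u. Proof. exact: rst_sym. Qed.
Lemma eqv_trans v u w : eqv u v -> eqv v w -> eqv u w.
Proof. exact: rst_trans. Qed.

#[local] Hint Resolve eqv_refl : core.

Lemma eqv_cat a b u v : eqv u v -> eqv (a ++ u ++ b) (a ++ v ++ b).
Proof.
elim=> [{u v}_ _ [c [d [y [p [M [yM pM -> ->]]]]]]|//|u' v' _|u' v' w _ uv _];
  [| exact: eqv_sym | exact: eqv_trans].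
apply: rst_step; exists (a ++ c), (d ++ b), y, p, M.
by split; rewrite // -!catA.
Qed.

Lemma eqv_cons x u v : eqv u v -> eqv (x :: u) (x :: v).
Proof. by move/(@eqv_cat [:: x] [::]); rewrite /= !cats0. Qed.

Lemma eqv_rot a b y p M : y < M -> p < M ->
  eqv (a ++ [:: y, p, M & b]) (a ++ [:: p, M, y & b]).
Proof. by move=> yM pM; apply: rst_step; exists a, b, y, p, M. Qed.

(** An ascent p M passes over any letter smaller than M, so it can be carried
    as a block anywhere among such letters. *)
Lemma eqv_pair_front a b p M : p < M -> all (fun y => y < M) a ->
  eqv (a ++ [:: p, M & b]) [:: p, M & a ++ b].
Proof.
move=> pM; elim: a => [//|y a IH] /= /andP[yM /IH ab].
apply: eqv_trans (eqv_cons y ab) _.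
exact: (@eqv_rot [::]).
Qed.

Lemma eqv_pair a b c d p M : p < M -> all (fun y => y < M) (a ++ b) ->
  a ++ b = c ++ d -> eqv (a ++ [:: p, M & b]) (c ++ [:: p, M & d]).
Proof.
move=> pM abM abcd; have cdM := abM; rewrite abcd in cdM.
move: abM cdM; rewrite !all_cat => /andP[aM _] /andP[cM _].
apply: eqv_trans (eqv_pair_front b pM aM) _; rewrite abcd.
exact: eqv_sym (eqv_pair_front d pM cM).
Qed.

Lemma eqv_perm u v : eqv u v -> perm_eq u v.
Proof.
elim=> [{u v}_ _ [a [b [y [p [M [_ _ -> ->]]]]]]|//|u' v' _|u' v' w _ uv _].
- by rewrite perm_cat2l (perm_catCA [:: y] [:: p; M]).
- by rewrite perm_sym.
exact: perm_trans.
Qed.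

(** * From permutations to words *)

Lemma nth_one_line n (s : 'S_n) (i : 'I_n) : nth 0 (one_line s) i = (s i).+1.
Proof. by rewrite (nth_map i) ?size_enum_ord // nth_ord_enum. Qed.

Lemma word_one_line n (s : 'S_n) : word n (one_line s).
Proof.
apply: uniq_perm; rewrite ?iota_uniq //.
  by rewrite map_inj_uniq ?enum_uniq // => i j [/val_inj/perm_inj].
move=> x; rewrite mem_iota add1n; apply/mapP/idP => [[i _ ->]|].
  by rewrite /= ltnS.
case: x => // x /= xn; exists (s^-1%g (Ordinal (xn : x < n))); rewrite ?mem_enum //.
by rewrite permKV.
Qed.

Lemma one_line_surj n w : word n w -> exists s : 'S_n, one_line s = w.
Proof.
move=> ww; have sw := word_size ww.
have wi (i : 'I_n) : 0 < nth 0 w i <= n.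
  by rewrite -(word_mem _ ww) mem_nth ?sw.
have wP (i : 'I_n) : (nth 0 w i).-1 < n by case/andP: (wi i); case: nth.
have inj : injective (fun i => Ordinal (wP i)).
  move=> i j [e]; apply/val_inj/eqP.
  rewrite -(nth_uniq 0 _ _ (word_uniq ww)) ?sw ?ltn_ord //.
  by move: e (wi i) (wi j); case: nth => //= ?; case: nth => //= ? ->.
exists (perm inj); apply: (@eq_from_nth _ 0); rewrite size_one_line ?sw //.
move=> i ii; rewrite (nth_one_line _ (Ordinal ii)) permE /=.
by have /andP[] := wi (Ordinal ii); case: nth.
Qed.

Lemma is_order_permP c u (s : 'S_c) :
  reflect (size u = c /\ forall i j, i < c -> j < c ->
    (nth 0 (one_line s) i < nth 0 (one_line s) j) = (nth 0 u i < nth 0 u j))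
  (is_order_perm u s).
Proof.
apply: (iffP andP) => -[su H]; split=> //.
- exact/eqP.
- move=> i j ii jj.
  have /forallP/(_ (Ordinal jj))/eqP/= <- := forallP H (Ordinal ii).
  by rewrite (nth_one_line s (Ordinal ii)) (nth_one_line s (Ordinal jj)).
- exact/eqP.
apply/forallP=> i; apply/forallP=> j; rewrite -H //.
by rewrite !nth_one_line.
Qed.

(** The partition {123,231}{213,132} of the permutations of three letters. *)
Definition K3 : {set {set 'S_3}} :=
  replacement_partition 3 [:: [:: [:: 1; 2; 3]; [:: 2; 3; 1]];
                              [:: [:: 2; 1; 3]; [:: 1; 3; 2]]].

(** Two arrangements of the same letters with the same relative order are
    equal: a letter is determined by the number of smaller letters. *)
Lemma order_iso_eq u v : perm_eq u v ->
  (forall i j, i < size u -> j < size u ->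
    (nth 0 u i < nth 0 u j) = (nth 0 v i < nth 0 v j)) -> u = v.
Proof.
move=> uv H; have suv := perm_size uv.
apply: (@eq_from_nth _ 0) => // i ii.
have rank : count (fun x => x < nth 0 u i) u = count (fun x => x < nth 0 v i) u.
  have countE w (a : pred nat) : count a w = \sum_(j < size w | a (nth 0 w j)) 1.
    by rewrite -sum1_count (big_nth 0) big_mkord.
  rewrite [RHS](seq.permP uv) !countE -suv.
  by apply: eq_bigl => j; rewrite H.
have lt_rank x y : x \in u -> x < y ->
    count (fun z => z < x) u < count (fun z => z < y) u.
  move=> xu xy; rewrite -(cat_take_drop (index x u) u) !count_cat.
  rewrite (drop_nth 0) ?index_mem // nth_index //= ltnn xy add0n add1n addnS ltnS.
  by apply: leq_add; apply: sub_count => z /= zx; apply: ltn_trans xy.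
have ui : nth 0 u i \in u by rewrite mem_nth.
have vi : nth 0 v i \in u by rewrite (perm_mem uv) mem_nth -?suv.
case: (ltngtP (nth 0 u i) (nth 0 v i)) => // [/(lt_rank _ _ ui)|/(lt_rank _ _ vi)];
  by rewrite rank ltnn.
Qed.

(** When the order permutations of u and v are xyz and yzx with z the largest,
    as in both nontrivial parts of K3, v is u rotated once. *)
Lemma order_perm_rotates u v (s t : 'S_3) x y z : perm_eq u v ->
  one_line s = [:: x; y; z] -> one_line t = [:: y; z; x] ->
  x < z -> y < z ->
  is_order_perm u s -> is_order_perm v t ->
  rotates u v.
Proof.
move=> uv es et xz yz /is_order_permP[su us] /is_order_permP[sv vt].
suff ev : rot 1 u = v.
  case: u su us uv ev => [|u0 [|u1 [|u2 []]]] // _ us _ <-.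
  exists [::], [::], u0, u1, u2; split=> //.
    by rewrite -(us 0 2) // es.
  by rewrite -(us 1 2) // es.
apply: order_iso_eq; rewrite ?perm_rot // size_rot su.
move=> i j ii jj; rewrite -vt // et.
case: u su us uv => [|u0 [|u1 [|u2 []]]] // _ us _.
move: (us 0 1 isT isT) (us 0 2 isT isT) (us 1 2 isT isT)
  (us 1 0 isT isT) (us 2 0 isT isT) (us 2 1 isT isT); rewrite es /=.
case: i ii => [|[|[|]]] //; case: j jj => [|[|[|]]] //= *; lia.
Qed.

Lemma same_part_eqv u v : perm_eq u v -> same_part K3 u v -> eqv u v.
Proof.
move=> uv /exists_inP[P PK /exists_inP[s sP /exists_inP[t tP /andP[us vt]]]].
have eq_case : one_line s = one_line t -> eqv u v.
  move=> st; suff -> : u = v by [].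
  case/is_order_permP: us => su us; case/is_order_permP: vt => sv vt.
  by apply: order_iso_eq => // i j; rewrite su => ii jj; rewrite -us // -vt // st.
have vu : perm_eq v u by rewrite perm_sym.
move: PK; rewrite !inE => /orP[/orP[]/eqP eP|/imsetP[x _ eP]];
  rewrite {}eP ?inE in sP tP; last first.
  by rewrite (eqP sP) (eqP tP) in eq_case *; apply: eq_case.
all: case/orP: sP => /eqP es; case/orP: tP => /eqP et;
 try (by apply: eq_case; rewrite es et).
all: first [by apply: rst_step; apply: (order_perm_rotates uv es et)
  | by apply/eqv_sym/rst_step; apply: (order_perm_rotates vu et es)].
Qed.

Lemma kstep_one_line n (phi psi : 'S_n) : kstep K3 phi psi ->
  eqv (one_line phi) (one_line psi).
Proof.
case/existsP=> k /and3P[/eqP e1 /eqP e2 uv3].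
have := word_one_line psi; have := word_one_line phi.
move: (one_line phi) (one_line psi) e1 e2 uv3 => w w' e1 e2 uv3 ww ww'.
have ew (x : seq nat) : x = take k x ++ take 3 (drop k x) ++ drop (k + 3) x.
  by rewrite addnC -drop_drop !cat_take_drop.
have : perm_eq w w' by rewrite (perm_trans ww) // perm_sym.
rewrite (ew w) (ew w') e1 e2 perm_cat2l perm_cat2r => /same_part_eqv/(_ uv3).
exact: eqv_cat.
Qed.

Lemma rotates_kstep n (phi psi : 'S_n) :
  rotates (one_line phi) (one_line psi) -> kstep K3 phi psi.
Proof.
case=> a [b [y [p [M [yM pM e1 e2]]]]]; apply/kstepP.
exists a, [:: y; p; M], [:: p; M; y], b; split=> //.
have ux : y != p.
  have := word_uniq (word_one_line phi); rewrite e1 cat_uniq /= inE.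
  by case: eqP => // _; rewrite !andbF.
have key (B : seq (seq nat)) v w : word 3 v -> word 3 w ->
  block_of_words 3 B \in K3 -> v \in B -> w \in B ->
  (forall i j, i < 3 -> j < 3 ->
     (nth 0 v i < nth 0 v j) = (nth 0 [:: y; p; M] i < nth 0 [:: y; p; M] j)) ->
  (forall i j, i < 3 -> j < 3 ->
     (nth 0 w i < nth 0 w j) = (nth 0 [:: p; M; y] i < nth 0 [:: p; M; y] j)) ->
  exists2 P, P \in K3 & exists sigma tau, [/\ sigma \in P, tau \in P,
    is_order_perm [:: y; p; M] sigma & is_order_perm [:: p; M; y] tau].
  move=> /one_line_surj[s <-] /one_line_surj[t <-] BK sB tB us vt.
  exists (block_of_words 3 B) => //; exists s, t.
  by rewrite !inE; split=> //; apply/is_order_permP.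
have [yp|py|e] := ltngtP y p; last by rewrite e eqxx in ux.
  apply: (key [:: [:: 1; 2; 3]; [:: 2; 3; 1]] [:: 1; 2; 3] [:: 2; 3; 1]) => //.
  - by rewrite !inE eqxx.
  - by move=> [|[|[|]]] // [|[|[|]]] //= _ _; lia.
  - by move=> [|[|[|]]] // [|[|[|]]] //= _ _; lia.
apply: (key [:: [:: 2; 1; 3]; [:: 1; 3; 2]] [:: 2; 1; 3] [:: 1; 3; 2]) => //.
- by rewrite !inE eqxx orbT.
- by move=> [|[|[|]]] // [|[|[|]]] //= _ _; lia.
by move=> [|[|[|]]] // [|[|[|]]] //= _ _; lia.
Qed.

Lemma kequiv_one_line n (phi psi : 'S_n) :
  kequiv K3 phi psi <-> eqv (one_line phi) (one_line psi).
Proof.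
split.
  move/kequivP; elim=> [x y|x|x y _|x y z _ xy _].
  - exact: kstep_one_line.
  - exact: eqv_refl.
  - exact: eqv_sym.
  exact: eqv_trans.
move: {-1}(one_line phi) {-1}(one_line psi)
  (erefl (one_line phi)) (erefl (one_line psi)) => u v.
move=> eu ev uv; apply/kequivP; elim: uv phi psi eu ev => {u v}.
- by move=> u v uv phi psi eu ev; apply/rst_step/rotates_kstep; rewrite eu ev.
- by move=> u phi psi <- /one_line_inj->; apply: rst_refl.
- by move=> u v _ IH phi psi eu ev; apply/rst_sym/IH.
move=> u v w uv IH1 _ IH2 phi psi eu ew.
have [chi ev] : exists s : 'S_n, one_line s = v.
  apply: one_line_surj; rewrite /word (perm_trans _ (word_one_line phi)) //.
  by rewrite eu perm_sym eqv_perm.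
by apply: rst_trans (IH1 _ _ eu ev) (IH2 _ _ ev ew).
Qed.

(** * Representatives *)

(** The decreasing word k ... 2 1, whose last two letters are exchanged when e
    holds and k is at least 2. *)
Fixpoint desc_end (e : bool) (k : nat) : seq nat :=
  if k is k'.+1 then
    if e && (k == 2) then [:: 1; 2] else k :: desc_end e k'
  else [::].

(** One word on k letters of each inversion parity; for k <= 1 there is only
    one word. *)
Definition ends k := if k <= 1 then [:: desc_end false k]
                      else [:: desc_end false k; desc_end true k].

(** The pairs (t, s) where s is k (k-1) ... (t+1) followed by an element of
    [ends (t-1)], for 1 <= t <= k.  The pair (t, s) stands for the word
    s on [1, k] minus t, together with a block t N, N a letter larger than k. *)
Fixpoint glued (k : nat) : seq (nat * seq nat) :=
  if k is k'.+1 then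
    [seq (ps.1, k :: ps.2) | ps <- glued k'] ++ [seq (k, s) | s <- ends k']
  else [::].

(** The representatives of the classes: n (n-1) ... (m+1), then a block t m and
    a word s with (t, s) in [glued (m-1)]; or the decreasing word. *)
Fixpoint reps (n : nat) : seq (seq nat) :=
  if n is n'.+1 then
    map (cons n) (reps n') ++ [seq [:: ps.1, n & ps.2] | ps <- glued n']
  else [:: [::]].

Lemma desc_end_word e k : e ==> (1 < k) -> word k (desc_end e k).
Proof.
elim: k => [|k IH]; first by case: e.
move=> /= ek; case: ifP => [/andP[_ /eqP->] //|ek2].
rewrite word_cons IH //; apply/implyP=> et; move: ek ek2; rewrite et /=.
by case: k {IH} => [|[]].
Qed.

Lemma ends_word k t : t \in ends k -> word k t.
Proof.
rewrite /ends; case: leqP => k1; rewrite !inE.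
  by move/eqP->; apply: desc_end_word.
by case/orP=> /eqP->; apply: desc_end_word.
Qed.

Lemma glued_word k ps : ps \in glued k -> word k (ps.1 :: ps.2).
Proof.
elim: k ps => // k IH ps; rewrite mem_cat => /orP[]/mapP[t tk ->] /=.
  by rewrite (word_ins k [:: t.1]) IH.
by rewrite word_cons ends_word.
Qed.

Lemma reps_word n w : w \in reps n -> word n w.
Proof.
elim: n w => [|n IH] w; first by rewrite inE => /eqP->.
rewrite mem_cat => /orP[]/mapP[r rn ->]; first by rewrite word_cons IH.
by rewrite (word_ins n [:: r.1]) (glued_word rn).
Qed.

Lemma size_ends k : size (ends k) = (1 < k).+1.
Proof. by rewrite /ends; case: leqP. Qed.

Lemma size_glued k : size (glued k.+2) = (k.+1).*2.
Proof.
elim: k => // k IH.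
by rewrite [glued _]/(_ ++ _) size_cat !size_map IH size_ends addn2.
Qed.

Lemma size_reps n : size (reps n.+2) = n.+1 * n + 2.
Proof.
elim: n => // n IH.
by rewrite [reps _]/(_ ++ _) size_cat !size_map IH size_glued -muln2; lia.
Qed.

(** * Every word is equivalent to a representative *)

(** In the presence of an ascent k N above all the other letters, any three
    consecutive letters z x y can be rotated.  The block k N, carried behind
    them, is split into two blocks y k and x N, and z passes over each of
    these; then k N is restored and carried back. *)
Lemma eqv_rot3 a b k N x y z :
  k < N -> all (fun x => x < k) (a ++ [:: z, x, y & b]) ->
  eqv [:: k, N & a ++ [:: z, x, y & b]] [:: k, N & a ++ [:: x, y, z & b]].
Proof.
move=> kN abk.
have [xk yk zk] : [/\ x < k, y < k & z < k].
  by move: abk; rewrite all_cat /= => /and5P[].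
have [xN yN zN] : [/\ x < N, y < N & z < N] by split; apply: ltn_trans kN.
have [aN bN] : all (fun x => x < N) a /\ all (fun x => x < N) b.
  move: abk; rewrite all_cat /= => /and5P[ak _ _ _ bk].
  by split; [move: ak|move: bk]; apply: sub_all => w /ltn_trans->.
apply: (@eqv_trans ((a ++ [:: z; x; y]) ++ [:: k, N & b])).
  apply: (@eqv_pair [::]) => //; last by rewrite -catA.
  by rewrite cat0s all_cat /= aN zN xN yN.
rewrite -catA /=.
apply: (@eqv_trans (a ++ [:: z, y, k, x, N & b])).
  by rewrite -![_ ++ z :: _]cat_rcons; apply: eqv_rot.
apply: (@eqv_trans (a ++ [:: y, k, z, x, N & b])).
  exact: eqv_rot.
apply: (@eqv_trans (a ++ [:: y, k, x, N, z & b])).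
  by have := @eqv_rot (a ++ [:: y; k]) b z x N zN xN; rewrite -!catA.
apply: (@eqv_trans (a ++ [:: x, y, k, N, z & b])).
  by apply: eqv_sym; apply: eqv_rot.
apply: (@eqv_trans ((a ++ [:: x; y]) ++ [:: k, N, z & b])); first by rewrite -catA.
apply: (@eqv_pair _ _ [::]) => //; last by rewrite -catA.
by rewrite -catA all_cat /= aN zN xN yN.
Qed.

(** Rotations of three letters bring any letter to the front, as soon as there
    are two others: two places at a time, and from the second place by rotating
    the first three letters. *)
Lemma eqv_bring_front k N a c d j : k < N -> all (fun x => x < k) (a ++ c ++ j :: d) ->
  1 < size (c ++ d) ->
  exists2 r, perm_eq (c ++ d) r &
    eqv [:: k, N & a ++ c ++ j :: d] [:: k, N & a ++ j :: r].
Proof.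
move=> kN; have [m] := ubnP (size c); elim: m c d => // m IH c d.
case/lastP: c => [_ _ _|c z]; first by exists d.
case/lastP: c => [_|c x].
  case: d => // z' d adk _; exists [:: z', z & d].
    by rewrite (perm_catCA [:: z] [:: z']).
  exact: eqv_rot3.
rewrite !cat_rcons !size_rcons ltnS => /ltnW cm adk _.
have eqv1 : eqv [:: k, N & a ++ c ++ [:: x, z, j & d]]
                [:: k, N & a ++ c ++ [:: j, x, z & d]].
  apply: eqv_sym; rewrite !catA; apply: eqv_rot3 => //.
  by move: adk; rewrite !all_cat /= => /and3P[-> ->] /and4P[-> -> -> ->].
have [|| r pr e] := IH c [:: x, z & d] cm.
- by move: adk; rewrite !all_cat /= => /and3P[-> ->] /and4P[-> -> -> ->].
- by rewrite size_cat /= !addnS.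
by exists r => //; apply: eqv_trans e.
Qed.

(** With the block k N at hand, and behind any letters smaller than k, every
    word on j letters is sorted into one of the two (or one) words of [ends j];
    this is the generation of the alternating group by 3-cycles of consecutive
    positions. *)
Lemma eqv_ends k N j a s :
  k < N -> j < k -> all (fun x => x < k) a -> word j s ->
  exists2 t, t \in ends j & eqv [:: k, N & a ++ s] [:: k, N & a ++ t].
Proof.
move=> kN; elim: j a s => [|j IH] a s jk ak ws.
  by exists [::] => //; case: s ws (word_size ws).
have sj : j.+1 \in s by rewrite (word_mem _ ws) /=.
case: (leqP 2 j) => j2; last first.
  exists s => //; case: j j2 jk sj ws {IH} => [|[|]] // _ _ _ ws.
    case: s ws (word_size ws) => [|x []] // ws _.
    by have := word_mem x ws; rewrite inE eqxx /ends /= => /esym; case: x ws => [|[]].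
  case: s ws (word_size ws) => [|x [|y []]] // ws _.
  have := word_uniq ws; have := word_mem y ws; have := word_mem x ws.
  rewrite !inE !eqxx orbT /= => /esym x2 /esym y2.
  by case: x x2 {ws} => [|[|[]]] //; case: y y2 => [|[|[]]].
case/splitPr: sj ws => c d ws; have wcd := ws; rewrite word_ins in wcd.
have [||r pr e] := eqv_bring_front (a := a) (c := c) (d := d) (j := j.+1) kN.
- by rewrite all_cat ak (word_all_lt ws).
- by rewrite (word_size wcd).
have [|||t tj et] := IH (rcons a j.+1) r.
- exact: ltnW.
- by rewrite all_rcons jk.
- by rewrite -(word_perm _ pr).
exists (j.+1 :: t); last by rewrite -!cat_rcons in e *; apply: eqv_trans e et.
have j1 : (j <= 1) = false by rewrite leqNgt j2.
move: tj; rewrite /ends j1 /= ltnNge (ltnW j2) /= !inE eqSS (gtn_eqF j2).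
by case/orP=> /eqP->; rewrite eqxx ?orbT.
Qed.

(** Normal form of a word containing the block p N, N above all the other
    letters.  A leading k+1 is kept in place; otherwise the partner p of N can
    be replaced by k+1 in one move, and the remaining letters are then sorted. *)
Lemma eqv_glued N k p s : k < N -> word k (p :: s) ->
  exists2 ps, ps \in glued k & eqv [:: p, N & s] [:: ps.1, N & ps.2].
Proof.
elim: k p s => [|k IH] p s kN ws; first by have := word_size ws.
have pk : p <= k.+1 by have := word_mem p ws; rewrite mem_head => /esym/andP[].
have pN := leq_ltn_trans pk kN.
have [[s' es]|nhead] : (exists s', s = k.+1 :: s') \/ head 0 s != k.+1.
- case: s {ws} => [|x s]; first by right.
  by case: (eqVneq x k.+1) => [->|]; [left; exists s|right].
  rewrite es (word_ins k [:: p]) in ws *.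
  have [[q t] qt e] := IH _ _ (ltnW kN) ws.
  exists (q, k.+1 :: t).
    by rewrite mem_cat (map_f (fun ps => (ps.1, k.+1 :: ps.2)) qt).
  have /andP[qN _] := word_all_lt (glued_word qt) (ltnW kN).
  apply: (@eqv_trans [:: k.+1, p, N & s']); first by apply/eqv_sym/(@eqv_rot [::]).
  apply: (@eqv_trans [:: k.+1, q, N & t]); first exact: eqv_cons.
  exact: (@eqv_rot [::]).
have [s' ws' e] : exists2 s', word k s' & eqv [:: p, N & s] [:: k.+1, N & s'].
  have [ep|pk'] := eqVneq p k.+1.
    by exists s; rewrite ep // in ws *; rewrite -word_cons.
  have /splitPr ks : k.+1 \in s.
    by have := word_mem k.+1 ws; rewrite inE eq_sym (negPf pk') /= ltnS leqnn.
  (* As k+1 is not the first letter of s, some y precedes it, and carrying the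
     block p N right after y (k+1) allows y (k+1) p -> p y (k+1). *)
  case: s / ks ws nhead => c d ws nhead.
  case/lastP: c ws nhead => [|c y] ws; rewrite ?eqxx // => _.
  rewrite cat_rcons in ws *.
  have wcd : word k (c ++ [:: p, y & d]).
    move: ws; rewrite (word_perm _ (permEl (perm_catCA [:: p] c _))).
    by rewrite (catA c [:: p] [:: y, k.+1 & d]) (catA _ [:: y] (k.+1 :: d)) word_ins -!catA.
  have cdN := word_all_lt wcd (ltnW kN).
  have [cN yN dN] : [/\ all (fun x => x < N) c, y < N & all (fun x => x < N) d].
    by move: cdN; rewrite all_cat /= => /and4P[].
  have yk : y < k.+1.
    by have := word_mem y wcd; rewrite !mem_cat !inE eqxx !orbT ltnS => /esym/andP[].
  exists (c ++ [:: p, y & d]) => //.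
  apply: (@eqv_trans ((c ++ [:: y; k.+1]) ++ [:: p, N & d])).
    apply: (@eqv_pair [::]) => //; last by rewrite -catA.
    by rewrite /= all_cat /= cN yN kN dN.
  apply: (@eqv_trans (c ++ [:: p, y, k.+1, N & d])).
    rewrite -catA /=; apply: eqv_sym.
    by apply: eqv_rot; rewrite // ltn_neqAle pk'.
  apply: (@eqv_trans ((c ++ [:: p; y]) ++ [:: k.+1, N & d])); first by rewrite -catA.
  apply: (@eqv_pair _ _ [::]) => //; last by rewrite -catA.
  by rewrite -catA all_cat /= cN pN yN dN.
have [t tk et] := @eqv_ends _ _ _ [::] _ kN (ltnSn k) isT ws'.
exists (k.+1, t); last exact: eqv_trans e et.
by rewrite mem_cat map_f ?orbT.
Qed.

Lemma eqv_reps n w : word n w -> exists2 r, r \in reps n & eqv w r.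
Proof.
elim: n w => [|n IH] w ww; first by exists [::] => //; case: w ww (word_size ww).
have nw : n.+1 \in w by rewrite (word_mem _ ww) /=.
case/splitPr: nw ww => c d; case/lastP: c => [|c p] ww.
  rewrite word_cons in ww; have [r rn e] := IH _ ww.
  exists (n.+1 :: r); last exact: eqv_cons.
  by rewrite mem_cat map_f.
have wcd : word n (p :: c ++ d).
  by rewrite -(word_perm _ (permEl (perm_catCA c [:: p] d))) /= -cat_rcons -word_ins.
have [ps psn e] := eqv_glued (ltnSn n) wcd.
exists [:: ps.1, n.+1 & ps.2].
  by rewrite mem_cat (map_f (fun ps => [:: ps.1, n.+1 & ps.2])) ?orbT.
rewrite cat_rcons; apply: eqv_trans e.
have /andP[pn cdn] := word_all_lt wcd (ltnSn n).
exact: (@eqv_pair _ _ [::]).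
Qed.

(** * The class invariant *)

(** The letter at which s stops agreeing with the decreasing word n (n-1) ... :
    if s begins with n ... (t+1) but not with n ... (t+1) t, the value is t. *)
Fixpoint run_end (n : nat) (s : seq nat) : nat :=
  if s is x :: s' then if x == n then run_end n.-1 s' else n else n.

(** Deletes the letter n and the letter before it; a leading n is not
    considered. *)
Fixpoint unglue (n : nat) (w : seq nat) : seq nat :=
  if w is p :: s then
    if s is q :: b then if q == n then b else p :: unglue n s else w
  else [::].

(** The pair (m, t): w begins with the run n (n-1) ... (m+1), and t is where the
    run (m-1) (m-2) ... stops at the beginning of what remains after deleting,
    from the rest of w, the letter m and its predecessor.  Both runs are
    maximal.  The value is (0, 0) on the decreasing word. *)
Fixpoint levels (n : nat) (w : seq nat) : nat * nat :=
  if w is x :: s then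
    if x == n then levels n.-1 s else (n, run_end n.-1 (unglue n w))
  else (0, 0).

(** The number of inversions of a word. *)
Fixpoint inversions (w : seq nat) : nat :=
  if w is x :: s then count (fun z => z < x) s + inversions s else 0.

(** A complete invariant of the equivalence on words on n letters: [levels]
    and the parity of the word. *)
Definition class_invariant n w := (levels n w, odd (inversions w)).

(** As long as a letter M <= n has not been met, any letter smaller than M stops
    the run. *)
Lemma run_end_cat n u c d y p M : y < M -> p < M -> M \notin u -> M <= n ->
  run_end n (u ++ y :: c) = run_end n (u ++ p :: d).
Proof.
move=> yM pM; elim: u n => [|x u IH] n /=.
  by move=> _ Mn; rewrite !ltn_eqF // (leq_trans _ Mn).
rewrite inE negb_or => /andP[Mx Mu] Mn; case: eqP => // xn.
by apply: IH => //; lia.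
Qed.

Lemma unglue_cat n a b p : n \notin a -> p != n ->
  unglue n (a ++ [:: p, n & b]) = a ++ b.
Proof.
move=> + pn; elim: a => [|x a IH] /=; first by rewrite eqxx.
rewrite inE negb_or => /andP[_ na]; move/(_ na): IH.
case: a na => [|z a] na IH; first by rewrite /= (negPf pn) eqxx.
rewrite -[RHS]/(x :: ((z :: a) ++ b)) -IH /=.
by move: na; rewrite inE negb_or eq_sym => /andP[/negPf->].
Qed.

(** A move involving n leaves the word without n and its predecessor unchanged.
    Any other move survives this deletion, except that it changes the
    predecessor of n when M comes just before n.  In all cases, the first letter
    where the two remaining words may differ is y in one and p in the other:
    both are smaller than M, so both stop the run. *)
Lemma rotates_unglue n a b y p M : y < M -> p < M ->
  word n (a ++ [:: y, p, M & b]) -> head 0 (a ++ [:: y]) != n ->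
  run_end n.-1 (unglue n (a ++ [:: y, p, M & b])) =
  run_end n.-1 (unglue n (a ++ [:: p, M, y & b])).
Proof.
move=> yM pM ww hn; have uw := word_uniq ww.
have := word_mem M ww; rewrite mem_cat !inE eqxx !orbT => /esym/andP[M0 Mn].
have [yn pn] : y != n /\ p != n by split; lia.
have [Ma Mb] : M \notin a /\ M \notin b.
  have := @uniq_notin M (a ++ [:: y; p]) b; rewrite -catA => /(_ uw)[].
  by rewrite mem_cat negb_or => /andP[].
have [eM|neM] := eqVneq M n.
  rewrite -eM in yn pn *.
  rewrite (unglue_cat (y :: b)) //.
  rewrite -cat_rcons unglue_cat ?cat_rcons // mem_rcons inE negb_or Ma.
  by rewrite eq_sym yn.
have Mn1 : M <= n.-1 by lia.
have nw : n \in a ++ [:: y, p, M & b].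
  by rewrite (word_mem _ ww); lia.
move: nw; rewrite mem_cat !inE ![n == _]eq_sym (negPf yn) (negPf pn) (negPf neM) /=.
case/orP=> /splitPr sp.
  case: a / sp Ma Mb ww uw hn => c d Ma Mb ww uw.
  case/lastP: c Ma ww uw => [|c q] Ma ww uw; first by rewrite eqxx.
  move=> _; move: (uw); rewrite -catA => /uniq_notin[].
  rewrite mem_rcons inE negb_or eq_sym => /andP[qn nc] _.
  move: Ma; rewrite mem_cat mem_rcons !inE !negb_or => /andP[/andP[_ Mc] /andP[_ Md]].
  rewrite -!catA /= !cat_rcons !unglue_cat // !catA.
  by apply: run_end_cat yM pM _ Mn1; rewrite mem_cat negb_or Mc.
case: b / sp Mb ww uw => c d Mb ww uw.
have /uniq_notin[+ _] : uniq ((a ++ [:: y, p, M & c]) ++ n :: d) by rewrite -catA.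
rewrite mem_cat !inE !negb_or => /andP[na /and4P[ny np nM nc]].
case/lastP: c nc Mb ww uw => [|c q] nc Mb ww _ /=.
  have nx : n \notin a ++ [:: y; p] by rewrite mem_cat !inE !negb_or na ny np.
  have nz : n \notin a ++ [:: p; M] by rewrite mem_cat !inE !negb_or na nM np.
  have := unglue_cat d nx neM; have := unglue_cat d nz yn.
  rewrite -!catA /= => -> ->.
  exact: run_end_cat yM pM Ma Mn1.
move: nc; rewrite mem_rcons inE negb_or eq_sym => /andP[qn nc].
have nx : n \notin a ++ [:: y, p, M & c].
  by rewrite mem_cat !inE !negb_or na ny np nM.
have nz : n \notin a ++ [:: p, M, y & c].
  by rewrite mem_cat !inE !negb_or na ny np nM.
have := unglue_cat d nx qn; have := unglue_cat d nz qn.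
rewrite -!catA !cat_rcons /= => -> ->.
exact: run_end_cat yM pM Ma Mn1.
Qed.

Lemma levels_rotates n w w' : word n w -> rotates w w' ->
  levels n w = levels n w'.
Proof.
move=> ww [a [b [y [p [M [yM pM e1 e2]]]]]]; subst w w'.
elim: a n ww => [|x a IH] n ww.
  have := word_mem M ww; rewrite !inE eqxx !orbT => /esym/andP[_ Mn].
  have := @rotates_unglue n [::] b y p M yM pM ww.
  have [yn pn] : y < n /\ p < n by split; apply: leq_trans Mn.
  by rewrite /= !(ltn_eqF yn) (ltn_eqF pn) => ->.
rewrite /=; case: (eqVneq x n) => [xn|xn].
  case: n xn ww => [|n] -> ww; last by apply: IH; rewrite -word_cons.
  by have := word_size ww.
by have := rotates_unglue yM pM ww xn => /= ->.
Qed.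

Lemma odd_inversions_cat a s t :
  perm_eq s t -> odd (inversions s) = odd (inversions t) ->
  odd (inversions (a ++ s)) = odd (inversions (a ++ t)).
Proof.
move=> st e; elim: a => //= x a IH.
by rewrite !oddD IH !count_cat (seq.permP st).
Qed.

Lemma odd_inversions_rotates w w' : uniq w -> rotates w w' ->
  odd (inversions w) = odd (inversions w').
Proof.
move=> uw [a [b [y [p [M [yM pM e1 e2]]]]]]; subst w w'.
apply: odd_inversions_cat; first by rewrite (perm_catCA [:: y] [:: p; M]).
have yp : y != p.
  by move: uw; rewrite cat_uniq /= inE; case: eqP => // _; rewrite !andbF.
rewrite /=; have -> : (y < p) = ~~ (p < y).
  by rewrite -leqNgt [RHS]leq_eqVlt (negPf yp).
rewrite /= yM (ltnNge M y) (ltnNge M p) (ltnW yM) (ltnW pM) /= !oddD !oddb /=.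
by case: (p < y); do 4!case: (odd _).
Qed.

Lemma class_invariant_eqv n u v : word n u -> eqv u v ->
  class_invariant n u = class_invariant n v.
Proof.
move=> + uv; elim: uv => {u v} [u v uv wu|//|u v uv IH wv|u v w uv IH1 _ IH2 wu].
- by rewrite /class_invariant (levels_rotates wu uv) (odd_inversions_rotates (word_uniq wu) uv).
- by rewrite IH // (word_perm _ (eqv_perm uv)).
by rewrite IH1 // IH2 // -(word_perm _ (eqv_perm uv)).
Qed.

(** * The representatives are pairwise inequivalent *)

Lemma count_lt_all n s : all (fun x => x < n) s ->
  count (fun x => x < n) s = size s.
Proof. by rewrite all_count => /eqP. Qed.

(** Exchanging the last two letters changes the parity, so the elements of
    [ends k] have different parities. *)
Lemma odd_inversions_ends k : uniq [seq odd (inversions t) | t <- ends k].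
Proof.
rewrite /ends; case: leqP => //= k1; rewrite inE andbT.
have -> : odd (inversions (desc_end true k)) =
          ~~ odd (inversions (desc_end false k)); last by case: odd.
elim: k k1 => // k IH k1 /=; case: eqP => [[->] //|/eqP k2].
have k1' : 1 < k by lia.
have lt e : e ==> (1 < k) -> count (fun x => x < k.+1) (desc_end e k) = k.
  move/desc_end_word => wt; rewrite count_lt_all ?(word_size wt) //.
  exact: word_all_lt wt _.
by rewrite !oddD !lt ?IH //; case: (odd k); case: odd.
Qed.

Lemma run_end_le n s : run_end n s <= n.
Proof.
by elim: s n => //= x s IH n; case: ifP => // _; apply: leq_trans (IH _) (leq_pred _).
Qed.

(** The part of the invariant of p n s that depends on (p, s), for n larger than
    all the letters of p s. *)
Definition glued_invariant k (ps : nat * seq nat) :=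
  (run_end k ps.2, odd (inversions (ps.1 :: ps.2))).

Lemma run_end_word k s : word k s -> run_end k.+1 s = k.+1.
Proof.
case: s => //= x s /(word_mem x); rewrite mem_head => /esym/andP[_ xk].
by rewrite ltn_eqF // ltnS.
Qed.

Lemma uniq_glued_invariant k : uniq (map (glued_invariant k) (glued k)).
Proof.
elim: k => //= k IH; rewrite map_cat cat_uniq -!map_comp.
(* Inserting k+1 after the first letter of a word on k letters adds k-1
   inversions. *)
pose f (i : nat * bool) := (i.1, odd k.-1 (+) i.2).
have fI : injective f by move=> [i b] [j c] [-> /addbI->].
have e1 : {in glued k, glued_invariant k.+1 \o (fun ps => (ps.1, k.+1 :: ps.2))
             =1 f \o glued_invariant k}.
  move=> [p s] /glued_word /= ws.
  have /andP[pk sk] := word_all_lt ws (ltnSn k).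
  rewrite /glued_invariant /f /= eqxx; congr (_, _).
  have -> : k.-1 = size s by rewrite -(word_size ws).
  by rewrite ltnNge (ltnW pk) /= add0n (count_lt_all sk) !oddD addbCA.
have e2 : {in ends k, glued_invariant k.+1 \o (fun s => (k.+1, s))
             =1 (fun b => (k.+1, odd k (+) b)) \o (fun s => odd (inversions s))}.
  move=> s /ends_word ws; rewrite /glued_invariant /= run_end_word //.
  by rewrite count_lt_all ?(word_all_lt ws) // (word_size ws) oddD.
move/eq_in_map: e1 => ->; move/eq_in_map: e2 => ->; rewrite (map_comp f).
rewrite (map_comp _ (fun t => odd (inversions t))).
rewrite (map_inj_uniq fI) IH /=; apply/andP; split.
  apply/hasPn=> _ /mapP[b _ ->]; apply/mapP=> -[_ /mapP[ps _ ->] [kt _]].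
  by have := run_end_le k ps.2; rewrite -kt ltnn.
by rewrite map_inj_uniq ?odd_inversions_ends // => b c [/addbI].
Qed.

Lemma levels_le n w : (levels n w).1 <= n.
Proof.
elim: w n => //= x w IH n; case: ifP => // _.
exact: leq_trans (IH _) (leq_pred _).
Qed.

Lemma uniq_class_invariant n : uniq (map (class_invariant n) (reps n)).
Proof.
elim: n => //= n IH; rewrite map_cat cat_uniq -!map_comp.
(* A leading n+1 adds n inversions; inserted in second place it adds n-1. *)
pose f (i : nat * nat * bool) := (i.1, odd n (+) i.2).
pose g (i : nat * bool) := ((n.+1, i.1), odd n.-1 (+) i.2).
have fI : injective f by move=> [i b] [j c] [-> /addbI->].
have gI : injective g by move=> [i b] [j c] [-> /addbI->].
have e1 : {in reps n, class_invariant n.+1 \o cons n.+1 =1 f \o class_invariant n}.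
  move=> w /reps_word ww; rewrite /class_invariant /f /= eqxx; congr (_, _).
  by rewrite count_lt_all ?(word_all_lt ww) // (word_size ww) oddD.
have e2 : {in glued n, class_invariant n.+1 \o (fun ps => [:: ps.1, n.+1 & ps.2])
             =1 g \o glued_invariant n}.
  move=> [p s] /glued_word /= ws.
  have /andP[pn sn] := word_all_lt ws (ltnSn n).
  rewrite /class_invariant /g /glued_invariant /= (ltn_eqF pn) eqxx; congr (_, _).
  have -> : n.-1 = size s by rewrite -(word_size ws).
  by rewrite ltnNge (ltnW pn) /= add0n (count_lt_all sn) !oddD addbCA.
move/eq_in_map: e1 => ->; move/eq_in_map: e2 => ->; rewrite (map_comp f) (map_comp g).
rewrite (map_inj_uniq fI) IH (map_inj_uniq gI) uniq_glued_invariant andbT /=.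
apply/hasPn=> _ /mapP[i _ ->]; apply/mapP=> -[_ /mapP[w _ ->] [e _]].
by have := levels_le n w; rewrite -e ltnn.
Qed.

(** * Counting the classes *)

Lemma card_kclasses n : #|kclasses K3 n| = size (reps n).
Proof.
pose cls (s : 'S_n) := [set t in [set: 'S_n] | kequiv K3 s t].
pose S := [set s : 'S_n | one_line s \in reps n].
have cls_eq s t : (cls s == cls t) = kequiv K3 s t.
  apply/eqP/idP => [e|st].
    have : t \in cls t by rewrite !inE /kequiv connect0.
    by rewrite -e !inE.
  apply/setP=> u; rewrite !inE /=.
  by have [_ ->] := kequiv_equivalence K3 (in_setT s) (in_setT t) (in_setT u).
have -> : kclasses K3 n = cls @: S.
  apply/setP=> C; apply/imsetP/imsetP => -[s _ ->]; last by exists s.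
  have [r rn sr] := eqv_reps (word_one_line s).
  have [t et] := one_line_surj (reps_word rn).
  exists t; first by rewrite inE et.
  by apply/eqP; rewrite -/(cls s) cls_eq; apply/kequiv_one_line; rewrite et.
rewrite card_in_imset => [|s t sS tS /eqP].
  rewrite cardE -(size_map (@one_line n)).
  apply: perm_size; apply: uniq_perm.
  - by rewrite map_inj_uniq ?enum_uniq //; apply: one_line_inj.
  - exact: map_uniq (uniq_class_invariant n).
  move=> w; apply/mapP/idP => [[s]|wn]; first by rewrite mem_enum inE => ? ->.
  have [s es] := one_line_surj (reps_word wn).
  by exists s; rewrite // mem_enum inE es.
rewrite cls_eq => /kequiv_one_line/(class_invariant_eqv (word_one_line s)) e.
rewrite !inE in sS tS; apply: one_line_inj.
rewrite -(nth_index [::] sS) -(nth_index [::] tS); congr nth.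
apply/eqP; rewrite -(nth_uniq (class_invariant n [::]) _ _ (uniq_class_invariant n));
  rewrite ?size_map ?index_mem //.
by rewrite !(nth_map [::]) ?index_mem // !nth_index // e.
Qed.

Theorem proposition3p24 (n : nat) (hn : 3 <= n) :
  let K := replacement_partition 3
             [:: [:: [:: 1; 2; 3]; [:: 2; 3; 1]];
                 [:: [:: 2; 1; 3]; [:: 1; 3; 2]]] in
  #|kclasses K n| = n ^ 2 - 3 * n + 4.
Proof.
rewrite /= -/K3 card_kclasses; case: n hn => [|[|[|n]]] // _.
by rewrite size_reps -mulnn; lia.
Qed.
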